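(* Let $k$ be a kernel with finite support, i.e. $\#\operatorname{supp} k = 2N$ for some $N\in\mathbb{N}$. Then the operator $\mathcal{L}$ associated with $k$ satisfies $CD(0,2N)$.
   Context: A kernel is a function $k:\mathbb{Z}\to[0,\infty)$ with $k(0)=0$, $k(-j)=k(j)$ for all $j\in\mathbb{N}$, and $0<|k|_1:=\sum_{j\in\mathbb{Z}}k(j)<\infty$. The associated operator is $\mathcal{L}u(x)=\sum_{j\in\mathbb{Z}}k(j)\big(u(x+j)-u(x)\big)$, $x\in\mathbb{Z}$, and the iterated carré du champ operator is given by $\Gamma_2(u)(x)=\frac14\sum_{j,l\in\mathbb{Z}}k(j)k(l)\big(u(x+j+l)-u(x+j)-u(x+l)+u(x)\big)^2\in[0,\infty]$. A function $u:\mathbb{Z}\to\mathbb{R}$ is admissible for $CD(0,d)$ at $x\in\mathbb{Z}$ if $\sum_{j\in\mathbb{Z}}k(j)|u(x+j)|<\infty$. For $d\in(0,\infty)$, $\mathcal{L}$ satisfies $CD(0,d)$ if $\Gamma_2(u)(x)\ge\frac1d\big(\mathcal{L}u(x)\big)^2$ for every $x\in\mathbb{Z}$ and every $u$ admissible at $x$. Here $\operatorname{supp}k=\{j\in\mathbb{Z}: k(j)\neq0\}$. *)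

(* Defs.v *)
From HB Require Import structures.
From mathcomp Require Import all_boot all_order all_algebra.
From mathcomp Require Import all_classical all_reals ereal numfun esum.

Set Implicit Arguments.
Unset Strict Implicit.
Unset Printing Implicit Defensive.

Import Order.TTheory GRing.Theory Num.Theory.

Local Open Scope classical_set_scope.
Local Open Scope ring_scope.

Section defs.
Variable R : realType.
Implicit Types (k u : int -> R) (x : int) (d : R).

Definition kernel_norm k : \bar R := \esum_(j in [set: int]) (k j)%:E.

Definition is_kernel k : Prop :=
  [/\ forall j : int, 0 <= k j,
      k 0 = 0,
      forall j : nat, k (- j%:Z) = k j%:Z
    & (0 < kernel_norm k < +oo)%E].

Definition supp k : set int := [set j | k j != 0].

(* [esum] is only meaningful for nonnegative families, so an absolutely
   convergent sum of signed terms is the difference of the sums of the positive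
   and negative parts. *)
Definition signed_esum (f : int -> \bar R) : \bar R :=
  (\esum_(j in [set: int]) (f^\+ j) - \esum_(j in [set: int]) (f^\- j))%E.

Definition Lop k u x : \bar R :=
  signed_esum (fun j => (k j * (u (x + j) - u x))%:E).

Definition Gamma2 k u x : \bar R :=
  ((4^-1)%:E * \esum_(p in [set: int * int])
     (k p.1 * k p.2 *
      (u (x + p.1 + p.2) - u (x + p.1) - u (x + p.2) + u x) ^+ 2)%:E)%E.

Definition admissible k u x : Prop :=
  (\esum_(j in [set: int]) (k j * `|u (x + j)|)%:E < +oo)%E.

(* For a kernel [k] and [u] admissible at [x], [Lop k u x] is finite. *)
Definition CD0 k d : Prop :=
  forall x u, admissible k u x ->
    ((d^-1)%:E * Lop k u x ^+ 2 <= Gamma2 k u x)%E.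

End defs.

(* Main.v *)
Require Import Defs.
From HB Require Import structures.
From mathcomp Require Import all_boot all_order all_algebra.
From mathcomp Require Import all_classical all_reals ereal numfun esum.
From mathcomp Require Import ring lra.

(** Write [a_j = u (x + j) - u x] and [S = supp k], a finite set that is stable
    under negation because [k] is even.  Among the nonnegative terms of
    [Gamma2 k u x], the antidiagonal ones, with indices [(j, -j)], are special:
    there [x + j - j] is again [x], so the second difference of [u] collapses
    to [- (a_j + a_(-j))] and, [k] being even, the
    term is [(k j * (a_j + a_(-j))) ^ 2].  These
    terms alone bound [Gamma2] from below ([Gamma2_ge_antidiagonal]).
    Averaging [L u (x) = \sum_S k j * a_j] over [j <-> -j] expresses it through
    the same quantities, [2 * L u (x) = \sum_S k j * (a_j + a_(-j))]
    ([Lop_symmetrized]), and the Cauchy-Schwarz inequality over the [2N]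
    elements of [S] ([sqr_sum_le]) gives
    [4 * (L u (x)) ^ 2 <= 2N * (4 * Gamma2 k u x)]. *)

Set Implicit Arguments.
Unset Strict Implicit.
Unset Printing Implicit Defensive.

Import Order.TTheory GRing.Theory Num.Theory.

Local Open Scope classical_set_scope.
Local Open Scope card_scope.
Local Open Scope ring_scope.

(** Cauchy-Schwarz against the constant family 1: expand the square and apply
    [a * b <= (a ^ 2 + b ^ 2) / 2] to each product. *)
Lemma sqr_sum_le (R : realFieldType) (I : Type) (s : seq I) (F : I -> R) :
  (\sum_(i <- s) F i) ^+ 2 <= (size s)%:R * \sum_(i <- s) F i ^+ 2.
Proof.
have -> : (size s)%:R * \sum_(i <- s) F i ^+ 2 =
    \sum_(i <- s) \sum_(j <- s) (F i ^+ 2 + F j ^+ 2) / 2.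
  have -> : \sum_(i <- s) \sum_(j <- s) (F i ^+ 2 + F j ^+ 2) / 2 =
      (\sum_(i <- s) \sum_(j <- s) F i ^+ 2 +
       \sum_(i <- s) \sum_(j <- s) F j ^+ 2) / 2.
    rewrite -big_split mulr_suml; apply: eq_bigr => i _.
    by rewrite -big_split mulr_suml.
  rewrite [X in X + _]exchange_big /= big_const_seq count_predT iter_addr_0.
  by rewrite -mulr_natl; field.
rewrite expr2 mulr_suml; apply: ler_sum => i _.
rewrite mulr_sumr; apply: ler_sum => j _.
by have := sqr_ge0 (F i - F j); lra.
Qed.

Lemma esum_finite_support (R : realType) (T : choiceType) (A : set T)
    (f : T -> \bar R) :
  finite_set A -> (forall i, 0 <= f i)%E -> (forall i, ~ A i -> f i = 0%E) ->
  (\esum_(i in [set: T]) f i = \sum_(i \in A) f i)%E.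
Proof.
move=> finA f0 fA; rewrite -esum_fset// [RHS]esum_mkcond.
by apply: eq_esum => i _; case: ifPn => // /negP; rewrite inE => /fA.
Qed.

Lemma signed_esum_finite_support (R : realType) (A : set int) (g : int -> R) :
  finite_set A -> (forall j, ~ A j -> g j = 0) ->
  signed_esum (fun j => (g j)%:E) = (\sum_(j \in A) g j)%:E.
Proof.
move=> finA gA; rewrite /signed_esum !(esum_finite_support finA); last 4 first.
- by move=> j; exact: funeneg_ge0.
- by move=> j /gA gj; rewrite funenegE gj oppe0 maxxx.
- by move=> j; exact: funepos_ge0.
- by move=> j /gA gj; rewrite funeposE gj maxxx.
under eq_fsbigr do rewrite funeposE -EFin_max.
under [X in (_ - X)%E]eq_fsbigr do rewrite funenegE -EFinN -EFin_max.
rewrite !fsumEFin// -EFinB; congr EFin.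
rewrite !fsbig_finite// -sumrB; apply: eq_bigr => j _.
exact: (congr1 (@^~ j) (funrposBneg g)).
Qed.

Section kernel.
Variables (R : realType) (k : int -> R).
Hypothesis kerk : is_kernel k.
Hypothesis fink : finite_set (supp k).
Implicit Types (u : int -> R) (x : int).

Lemma kernel_even j : k (- j) = k j.
Proof.
case: kerk => _ _ kN _; case: j => n; first exact: kN.
by rewrite NegzE opprK kN.
Qed.

Lemma supp_opp_bij : set_bij (supp k) (supp k) (-%R : int -> int).
Proof.
split; first by move=> j; rewrite /supp/= kernel_even.
- by move=> i j _ _; exact: oppr_inj.
- by move=> j kj; exists (- j); rewrite ?opprK// /supp/= kernel_even.
Qed.

Definition second_diff u x j : R := u (x + j) + u (x - j) - 2 * u x.

(** Both sides are additive in the increments, and [j <-> -j] preserves [k] and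
    its support. *)
Lemma Lop_symmetrized u x :
  Lop k u x = (2^-1 * \sum_(j \in supp k) k j * second_diff u x j)%:E.
Proof.
rewrite /Lop (@signed_esum_finite_support _ (supp k))//; last first.
  by move=> j /negP; rewrite negbK => /eqP ->; rewrite mul0r.
congr EFin.
set S := LHS.
have SN : S = \sum_(j \in supp k) k j * (u (x - j) - u x).
  rewrite /S (reindex_fsbig _ _ _ _ supp_opp_bij).
  by apply: eq_fsbigr => j _; rewrite kernel_even.
suff <- : S + S = \sum_(j \in supp k) k j * second_diff u x j by field.
rewrite {2}SN /S !fsbig_finite// -big_split; apply: eq_bigr => j _ /=.
by rewrite /second_diff; ring.
Qed.

(** The indices [(j, -j)] with [j] in the support form a finite set, so the sum
    over them is one of the finite partial sums bounding the full sum. *)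
Lemma Gamma2_ge_antidiagonal u x :
  ((4^-1 * \sum_(j \in supp k) (k j * second_diff u x j) ^+ 2)%:E
    <= Gamma2 k u x)%E.
Proof.
rewrite /Gamma2 EFinM lee_pmul2l// ?lte_fin ?invr_gt0//.
pose h (j : int) := (j, - j).
apply: esum_ge; exists (h @` supp k); first by split=> //; exact: finite_image.
have hbij : set_bij (supp k) (h @` supp k) h.
  by split=> [|i j _ _ []|] //; exact: image_subset.
rewrite (reindex_fsbig _ _ _ _ hbij) fsumEFin// lee_fin.
rewrite le_eqVlt; apply/orP; left; apply/eqP; apply: eq_fsbigr => j _ /=.
by rewrite kernel_even addrK /second_diff; ring.
Qed.

End kernel.

Theorem theorem2p1 (R : realType) (k : int -> R) (N : nat) :
  is_kernel k -> supp k #= `I_(2 * N) -> CD0 k (2 * N)%:R.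
Proof.
move=> kerk cardk x u _.
have fink : finite_set (supp k) by apply/finite_setP; exists (2 * N)%N.
apply: le_trans (Gamma2_ge_antidiagonal kerk fink u x).
rewrite (Lop_symmetrized kerk fink) -EFin_expe -EFinM lee_fin !fsbig_finite//.
set s := finmap.enum_fset (fset_set (supp k)).
have := sqr_sum_le s (fun j => k j * second_diff u x j).
have -> : size s = (2 * N)%N := card_fset_set cardk.
set B := \sum_(j <- s) _; set C := \sum_(j <- s) _ => BC.
have C0 : 0 <= C by apply: sumr_ge0 => j _; exact: sqr_ge0.
have [->|N0] := eqVneq (2 * N)%:R (0 : R).
  by rewrite invr0 mul0r mulr_ge0.
have Npos : 0 < (2 * N)%:R :> R by rewrite lt0r N0 ler0n.
rewrite mulrC ler_pdivrMr//; lra.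
Qed.
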